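(* All nonnegative functions in the class $\ell^{4,\infty}(\mathbb{Z}^d\times\mathbb{Z}^d)$ belong to $\mathcal B(\mathbb{Z}^d\times\mathbb{Z}^d)$.
   Context: $d\in\mathbb{N}$. For a countable set $K$ and $1\le q<\infty$, $\ell^{q,\infty}(K)$ is the set of complex sequences $a=\{a_k\}_{k\in K}$ with $\|a\|_{\ell^{q,\infty}(K)}=\sup_{t>0}\big\{t\,\sharp(\{k\in K:|a_k|>t\})^{1/q}\big\}<\infty$, where $\sharp$ denotes cardinality. $\mathcal B(\mathbb{Z}^d\times\mathbb{Z}^d)$ is the set of nonnegative functions $V$ on $\mathbb{Z}^d\times\mathbb{Z}^d$ for which there is a constant $c\in(0,\infty)$ such that $\sum_{\nu_1,\nu_2\in\mathbb{Z}^d}V(\nu_1,\nu_2)A(\nu_1+\nu_2)B(\nu_1)C(\nu_2)\le c\|A\|_{\ell^2(\mathbb{Z}^d)}\|B\|_{\ell^2(\mathbb{Z}^d)}\|C\|_{\ell^2(\mathbb{Z}^d)}$ for all nonnegative functions $A,B,C$ on $\mathbb{Z}^d$. *)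

(* Defs.v *)
From HB Require Import structures.
From mathcomp Require Import all_boot all_order all_algebra.
From mathcomp Require Import all_classical all_reals all_analysis.
From mathcomp Require Import complex.

Set Implicit Arguments.
Unset Strict Implicit.
Unset Printing Implicit Defensive.

Import Order.TTheory GRing.Theory Num.Theory.
Local Open Scope classical_set_scope.
Local Open Scope ring_scope.

Definition weak_lq_norm (R : realType) (K : countType) (q : R)
    (a : K -> R[i]) : \bar R :=
  ereal_sup
    [set (t%:E * @counting K R [set k | ((t%:C)%C < `|a k|)%R] `^ q^-1)%E
    | t in [set t : R | 0 < t]].

Definition weak_lq (R : realType) (K : countType) (q : R) : set (K -> R[i]) :=
  [set a | (weak_lq_norm q a < +oo)%E].

Definition l2_norm (R : realType) (K : countType) (A : K -> R) : \bar R :=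
  ((\esum_(k in [set: K]) (`|A k| ^+ 2)%:E) `^ 2^-1)%E.

(* A, B, C need not be in l^2, so the norms may be +oo. As 0 * +oo = 0 in
   \bar R, the bound is then vacuous, unless another norm is 0, in which case
   the left-hand side is 0 too. *)
Definition classB (R : realType) (d : nat) :
    set ('rV[int]_d * 'rV[int]_d -> R) :=
  [set V | (forall nu, 0 <= V nu) /\
    exists2 c : R, 0 < c &
      forall A B C : 'rV[int]_d -> R,
        (forall nu, 0 <= A nu) -> (forall nu, 0 <= B nu) ->
        (forall nu, 0 <= C nu) ->
        (\esum_(nu in [set: 'rV[int]_d * 'rV[int]_d])
           (V nu * A (nu.1 + nu.2) * B nu.1 * C nu.2)%:E
         <= c%:E * l2_norm A * l2_norm B * l2_norm C)%E].

(* Main.v *)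
Require Import Defs.
From mathcomp Require Import all_boot all_order all_algebra.
From mathcomp Require Import all_classical all_reals all_analysis.
From mathcomp Require Import complex.
From mathcomp Require Import zify ring lra.

Set Implicit Arguments.
Unset Strict Implicit.
Unset Printing Implicit Defensive.

Import Order.TTheory GRing.Theory Num.Theory.
Local Open Scope classical_set_scope.
Local Open Scope ring_scope.

(** Weak l^4 is the dual of the Lorentz space l^(4/3, 1), and the products
    A (x + y) B x C y with A, B, C in l^2 lie in that space.  The proof below
    is a direct form of this duality.

    Only finite sets of pairs (x, y) matter, as the left-hand side is a
    supremum of finite sums.  Weak l^4 control of V says that the sum of V over
    a finite set E is at most a constant times |E| ^ (3/4)
    ([sum_weak_l4]).  Order the support of A by decreasing values and cut it
    into shells of size about 2 ^ j, on which A is at most g_j with the sum of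
    2 ^ j g_j ^ 2 controlled by the squared l^2 norm ([dyadic_levels]); do the
    same for B and C, with shell indices k and l.  The pairs (x, y) for which
    x + y, x, y lie in the shells j, k, l are determined by any two of the
    three points, so that there are at most
    2 ^ (j + k + l - max (j, k, l)) of them.  With
    alpha_j = 2 ^ (j / 2) g_j, and likewise beta_k, gamma_l, the contribution
    of these pairs is therefore at most a constant times
      alpha_j beta_k gamma_l 2 ^ ((j + k + l - 3 max (j, k, l)) / 4).
    The last factor decays geometrically in the distances between the indices,
    so that the sum over all shells is bounded by the Cauchy-Schwarz
    inequality in (alpha, beta) and the trivial bound of gamma by its l^2 norm
    ([trilinear_gap], [finite_trilinear_bound]).

    Fractional powers of 2 are written as powers of q with q ^ 8 = 2: shell
    sizes bring in quarters, and spreading the decay over all three distances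
    costs another factor 2 in the exponent. *)

(** * Sums over finite sets of a function in weak l^4 *)

(** The weak l^4 quasi-norm in a form free of fractional powers and of infinite
    cardinals: the distribution function is tested on finite subsets of the
    superlevel sets. *)
Definition weak_l4_bound (R : realType) (T : eqType) (V : T -> R) (M : R) : Prop :=
  forall (t : R) (s : seq T), 0 < t -> uniq s -> (forall x, x \in s -> t < V x) ->
    (size s)%:R * t ^+ 4 <= M ^+ 4.

(** The exponent 3/4 comes from induction on n: at most 2 ^ n points have V
    above M / 2 ^ (n / 4), and the other points, at most 2 ^ (n + 1) in number,
    contribute at most 2 M 2 ^ (3 n / 4).  The constant 4 M survives the step
    because 2 ^ (3/4) is at least 3/2. *)
Lemma sum_weak_l4 (R : realType) (T : eqType) (V : T -> R) (M q : R) :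
  0 < M -> 1 <= q -> q ^+ 8 = 2 ->
  weak_l4_bound V M ->
  forall n (s : seq T), uniq s -> (size s <= 2 ^ n)%N ->
  \sum_(x <- s) V x <= 4 * M * q ^+ (6 * n).
Proof.
move=> M0 q1 q8 HV; have q0 : 0 < q by apply: lt_le_trans q1.
have q6 : 3 / 2 <= q ^+ 6.
  rewrite -(@ler_pXn2r _ 4) ?nnegrE ?exprn_ge0 ?ltW// -exprM.
  rewrite (_ : (6 * 4)%N = (8 * 3)%N)// exprM q8; lra.
elim=> [|n IHn] s us ss.
  have small x : x \in s -> V x <= 4 * M.
    move=> _; rewrite leNgt; apply/negP => Vx.
    have M40 : 0 < 4 * M by lra.
    have Vy y : y \in [:: x] -> 4 * M < V y by rewrite inE => /eqP ->.
    have := HV (4 * M) [:: x] M40 isT Vy; rewrite /= mul1r exprMn.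
    by have : 0 < M ^+ 4; [rewrite exprn_gt0 | lra].
  rewrite muln0 expr0 mulr1.
  case: s us ss small => [|x [|]]//= _ _ small.
    by rewrite big_nil; lra.
  by rewrite big_seq1 small ?mem_head.
set t := M / q ^+ (2 * n).
have t0 : 0 < t by rewrite divr_gt0 ?exprn_gt0.
rewrite (bigID (fun x => t < V x)) /= -big_filter.
have large : \sum_(i <- [seq i <- s | t < V i]) V i <= 4 * M * q ^+ (6 * n).
  apply: IHn; first exact: filter_uniq.
  have := HV t [seq i <- s | t < V i] t0 (filter_uniq _ us).
  have h : forall x, x \in [seq i <- s | t < V i] -> t < V x.
    by move=> x; rewrite mem_filter => /andP[].
  move=> /(_ h); rewrite /t expr_div_n -exprM mulrA ler_pdivrMr ?exprn_gt0//.
  rewrite [leLHS]mulrC ler_pM2l ?exprn_gt0//.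
  have -> : (2 * n * 4 = 8 * n)%N by lia.
  by rewrite (exprM q 8) q8 -natrX ler_nat.
have small : \sum_(i <- s | ~~ (t < V i)) V i <= 2 * M * q ^+ (6 * n).
  apply: (@le_trans _ _ (\sum_(i <- s | ~~ (t < V i)) t)).
    by apply: ler_sum => i; rewrite -leNgt.
  rewrite big_const_seq iter_addr_0 -[leLHS]mulr_natr.
  apply: (@le_trans _ _ (t * (2 ^ n.+1)%:R)).
    rewrite ler_wpM2l ?(ltW t0)//= ler_nat (leq_trans _ ss)//; exact: count_size.
  rewrite /t natrX -q8 -exprM (_ : (8 * n.+1 = 2 * n + 6 * n + 8)%N); last by lia.
  rewrite 2!exprD q8 le_eqVlt; apply/orP; left; apply/eqP.
  by field; rewrite expf_neq0 ?gt_eqF.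
apply: (le_trans (lerD large small)).
rewrite (_ : (6 * n.+1 = 6 * n + 6)%N); last by lia.
rewrite exprD; have : 0 < q ^+ (6 * n) by rewrite exprn_gt0.
move: (q ^+ (6 * n)) (q ^+ 6) q6 => a b b32 a0; have : 0 < M * a by rewrite mulr_gt0.
nra.
Qed.

(** * Dyadic shells of a finitely supported function *)

(** Half of the first 2 ^ j.+1 indices lie in [2 ^ j, 2 ^ j.+1), where a is at
    least its value at the last of them. *)
Lemma sum_dyadic_le (R : realFieldType) (a : nat -> R) :
  (forall i, 0 <= a i) -> (forall i j, (i <= j)%N -> a j <= a i) ->
  forall n, \sum_(j < n.+1) 2 ^+ j * a (2 ^ j - 1)%N ^+ 2 <=
            2 * \sum_(i < 2 ^ n) a i ^+ 2.
Proof.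
move=> a0 a_mono; elim=> [|n IHn].
  rewrite expn0 !big_ord1 subnn expr0 mul1r; have := sqr_ge0 (a 0%N).
  by rewrite /=; lra.
rewrite big_ord_recr/= (_ : (2 ^ n.+1)%N = (2 ^ n + 2 ^ n)%N); last by rewrite expnS; lia.
rewrite big_split_ord/= mulrDr; apply: lerD => //.
rewrite exprS -mulrA ler_wpM2l//.
have -> : 2 ^+ n * a (2 ^ n + 2 ^ n - 1)%N ^+ 2 =
   \sum_(i < 2 ^ n) a (2 ^ n + 2 ^ n - 1)%N ^+ 2.
  by rewrite sumr_const card_ord -[RHS]mulr_natl natrX.
apply: ler_sum => i _; rewrite lerXn2r ?nnegrE//; apply: a_mono.
have := ltn_ord i; lia.
Qed.

(** The level of a point is the integer part of the logarithm of its rank when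
    the points are listed by decreasing values of f; ties are broken
    arbitrarily by the sorting, which keeps the shells of size at most 2 ^ j. *)
Lemma dyadic_levels (R : realFieldType) (T : eqType) (s : seq T) (f : T -> R) :
  uniq s -> (forall x, 0 <= f x) ->
  exists (lev : T -> nat) (g : nat -> R),
    [/\ forall j, 0 <= g j,
        forall x, x \in s -> f x <= g (lev x),
        forall j, (size [seq x <- s | lev x == j] <= 2 ^ j)%N,
        forall x, (lev x <= size s)%N &
        forall n, \sum_(j < n.+1) 2 ^+ j * g j ^+ 2 <= 2 * \sum_(x <- s) f x ^+ 2].
Proof.
move=> us f0; pose leT := relpre f (>=%R).
have leTtot : total leT by move=> x y; exact: le_total.
have leTtr : transitive leT by move=> y x z /= xy yz; exact: le_trans yz xy.
pose t := sort leT s.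
have ts : perm_eq t s by rewrite /t perm_sort.
have st : sorted leT t by exact: sort_sorted.
pose a i := nth 0 (map f t) i.
have a0 i : 0 <= a i.
  rewrite /a; case: (ltnP i (size t)) => it.
    have [x0 _] : exists x0 : T, True by case: (t) it => // x0; exists x0.
    by rewrite (nth_map x0).
  by rewrite nth_default// size_map.
have a_mono i j : (i <= j)%N -> a j <= a i.
  move=> ij; case: (ltnP j (size t)) => jt; last first.
    by rewrite {1}/a nth_default ?size_map.
  have [x0 _] : exists x0 : T, True by case: (t) jt => // x0; exists x0.
  have it := leq_ltn_trans ij jt.
  rewrite /a !(nth_map x0)//.
  have leTr : reflexive leT by move=> x; rewrite /leT/=.
  by have := sorted_leq_nth leTtr leTr x0 st; apply.
pose lev x := trunc_log 2 (index x t).+1.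
have levP x : (2 ^ lev x <= (index x t).+1 < 2 ^ (lev x).+1)%N.
  by apply: trunc_log_bounds.
(* Ranks start at 1 and indices at 0, hence the shift. *)
exists lev, (fun j => a (2 ^ j - 1)%N); split => [//|x xs|j|x|n].
- have xt : x \in t by rewrite (perm_mem ts).
  have -> : f x = a (index x t).
    by rewrite /a (nth_map x) ?index_mem// nth_index.
  by apply: a_mono; have := levP x; lia.
- rewrite -(size_map (index^~ t)) -[leqRHS](size_iota (2 ^ j - 1)).
  apply: uniq_leq_size.
    rewrite map_inj_in_uniq ?filter_uniq// => x y.
    rewrite !mem_filter -!(perm_mem ts) => /andP[_ xt] /andP[_ yt] xy.
    by rewrite -(nth_index x xt) xy nth_index.
  move=> i /mapP[x]; rewrite mem_filter => /andP[/eqP <- _] ->.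
  by rewrite mem_iota; have := levP x; rewrite expnS; lia.
- have := levP x; have : (index x t <= size t)%N by exact: index_size.
  rewrite (perm_size ts); have := ltn_expl (lev x) (isT : (1 < 2)%N); lia.
apply: (le_trans (sum_dyadic_le a0 a_mono n)).
rewrite ler_wpM2l// -(perm_big _ ts)/=.
have -> : \sum_(x <- t) f x ^+ 2 = \sum_(i < size t) a i ^+ 2.
  rewrite -(big_map f xpredT (fun y => y ^+ 2)) (big_nth 0) size_map.
  by rewrite big_mkord.
rewrite -!(big_mkord xpredT (fun i => a i ^+ 2)).
case: (leqP (2 ^ n) (size t)) => h.
  rewrite (@big_cat_nat _ _ _ (2 ^ n) 0 (size t))//= lerDl.
  by apply: sumr_ge0 => i _; exact: sqr_ge0.
rewrite (@big_cat_nat _ _ _ (size t) 0 (2 ^ n)) ?(ltnW h)//= [X in _ + X]big_nat.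
rewrite [X in _ + X]big1 ?addr0// => i /andP[hi _].
by rewrite /a nth_default ?expr0n// size_map.
Qed.

(** * Trilinear sums with geometric decay off the diagonal *)

(** The bound keeps the term mu ^ j so that the induction on j closes; only
    the uniform bound 2 / (1 - mu) is of interest. *)
Lemma sum_expr_dist (R : realFieldType) (mu : R) (n j : nat) :
  0 <= mu -> mu < 1 ->
  (1 - mu) * \sum_(k < n) mu ^+ ((j - k) + (k - j)) <= 2 - mu ^+ j.
Proof.
move=> m0 m1; elim: j n => [|j IHj] n.
  rewrite (eq_bigr (fun k : 'I_n => mu ^+ k)); last first.
    by move=> k _; rewrite sub0n subn0.
  by rewrite -opprB mulNr -subrX1 expr0; have := exprn_ge0 n m0; lra.
case: n => [|n].
  by rewrite big_ord0 mulr0; have := exprn_ile1 j.+1 m0 (ltW m1); lra.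
rewrite big_ord_recl/=; have := IHj n.
rewrite subn0 addn0 exprS => h.
have := exprn_ge0 j m0 => mj.
rewrite (eq_bigr (fun k : 'I_n => mu ^+ ((j - k) + (k - j)))); last by [].
rewrite mulrDr; have := mulr_ge0 (sqr_ge0 (1 - mu)) mj; nra.
Qed.

(** Lagrange's identity: the difference of the two squared sides is half of the
    sum of w_i w_j (x_i y_j - x_j y_i) ^ 2. *)
Lemma weighted_CauchySchwarz (R : rcfType) (I : finType) (w x y : I -> R) :
  (forall i, 0 <= w i) ->
  \sum_i w i * x i * y i <=
  Num.sqrt (\sum_i w i * x i ^+ 2) * Num.sqrt (\sum_i w i * y i ^+ 2).
Proof.
move=> w0; rewrite -sqrtrM; last by apply: sumr_ge0 => i _; rewrite mulr_ge0 ?sqr_ge0.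
apply: (le_trans (ler_norm _)); rewrite -sqrtr_sqr ler_wsqrtr//.
set X := \sum_i w i * x i ^+ 2; set Y := \sum_i w i * y i ^+ 2.
set S := \sum_i _.
have : 0 <= \sum_i \sum_j w i * w j * (x i * y j - x j * y i) ^+ 2.
  by apply: sumr_ge0 => i _; apply: sumr_ge0 => j _; apply: mulr_ge0;
    [exact: mulr_ge0 | exact: sqr_ge0].
rewrite (_ : (\sum_i \sum_j _) = 2 * (X * Y - S ^+ 2)); first (by lra).
have -> : 2 * (X * Y - S ^+ 2) = X * Y + Y * X - 2 * (S * S) by ring.
rewrite /X /Y /S !big_distrlr/= mulr_sumr -big_split -sumrB/=.
apply: eq_bigr => i _; rewrite mulr_sumr -big_split -sumrB/=.
by apply: eq_bigr => j _; ring.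
Qed.

(** This is 2 (max - min) of the three indices.  The form as a sum of distances
    makes it evident that the decay in two of the distances can be used,
    whichever index is kept fixed. *)
Definition gap (j k l : nat) : nat :=
  ((j - k) + (k - j) + ((k - l) + (l - k)) + ((l - j) + (j - l)))%N.

(** A Schur test: for a fixed j the weights factor into two geometric sums. *)
Lemma sum_gap_sqr (R : realFieldType) (mu : R) (n : nat) (a : nat -> R) :
  0 <= mu -> mu < 1 ->
  \sum_(j < n) \sum_(k < n) \sum_(l < n) mu ^+ gap j k l * a j ^+ 2 <=
  (2 / (1 - mu)) ^+ 2 * \sum_(j < n) a j ^+ 2.
Proof.
move=> m0 m1; rewrite mulr_sumr; apply: ler_sum => j _.
pose d k := ((j - k) + (k - j))%N.
have dD : \sum_(k < n) mu ^+ d k <= 2 / (1 - mu).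
  rewrite ler_pdivlMr ?subr_gt0// mulrC.
  by apply: le_trans (sum_expr_dist n j m0 m1) _; rewrite gerBl exprn_ge0.
have dge0 : 0 <= \sum_(k < n) mu ^+ d k by apply: sumr_ge0 => k _; exact: exprn_ge0.
apply: (@le_trans _ _ ((\sum_(k < n) mu ^+ d k) ^+ 2 * a j ^+ 2)); last first.
  by rewrite ler_wpM2r ?sqr_ge0// lerXn2r ?nnegrE// (le_trans dge0).
rewrite [X in _ <= X * _]expr2 big_distrlr/= mulr_suml; apply: ler_sum => k _.
rewrite mulr_suml; apply: ler_sum => l _.
rewrite ler_wpM2r ?sqr_ge0// -exprD ler_wiXn2l ?(ltW m1)//.
rewrite /gap /d; lia.
Qed.

(** The third sequence only enters through its supremum, which its l^2 norm
    bounds; the other two are separated by Cauchy-Schwarz for the weights. *)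
Lemma trilinear_gap (R : rcfType) (mu : R) (n : nat) (a b c : nat -> R) :
  0 <= mu -> mu < 1 ->
  (forall j, 0 <= a j) -> (forall j, 0 <= b j) -> (forall j, 0 <= c j) ->
  \sum_(t : 'I_n * 'I_n * 'I_n)
    mu ^+ gap t.1.1 t.1.2 t.2 * a t.1.1 * b t.1.2 * c t.2 <=
  (2 / (1 - mu)) ^+ 2 * Num.sqrt (\sum_(j < n) a j ^+ 2) *
    Num.sqrt (\sum_(j < n) b j ^+ 2) * Num.sqrt (\sum_(j < n) c j ^+ 2).
Proof.
move=> m0 m1 a0 b0 c0.
have sum3 (F : 'I_n -> 'I_n -> 'I_n -> R) :
    \sum_(t : 'I_n * 'I_n * 'I_n) F t.1.1 t.1.2 t.2 =
    \sum_j \sum_k \sum_l F j k l.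
  by rewrite (pair_bigA _ (fun j k => \sum_l F j k l))/= pair_bigA.
have w0 (t : 'I_n * 'I_n * 'I_n) : 0 <= mu ^+ gap t.1.1 t.1.2 t.2 by exact: exprn_ge0.
set D := 2 / (1 - mu); set G := Num.sqrt (\sum_(j < n) c j ^+ 2).
have D0 : 0 <= D by rewrite divr_ge0// subr_ge0 ltW.
have cG (l : 'I_n) : c l <= G.
  rewrite -[leLHS](ger0_norm (c0 l)) -sqrtr_sqr ler_wsqrtr//.
  by rewrite (bigD1 l)//= lerDl; apply: sumr_ge0 => i _; exact: sqr_ge0.
apply: (@le_trans _ _ ((\sum_(t : 'I_n * 'I_n * 'I_n)
    mu ^+ gap t.1.1 t.1.2 t.2 * a t.1.1 * b t.1.2) * G)).
  by rewrite mulr_suml; apply: ler_sum => t _; rewrite ler_wpM2l// !mulr_ge0.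
rewrite ler_wpM2r ?sqrtr_ge0//.
apply: (le_trans (weighted_CauchySchwarz _ _ w0)).
have -> : D ^+ 2 * Num.sqrt (\sum_(j < n) a j ^+ 2) *
    Num.sqrt (\sum_(j < n) b j ^+ 2) =
  Num.sqrt (D ^+ 2 * \sum_(j < n) a j ^+ 2) * Num.sqrt (D ^+ 2 * \sum_(j < n) b j ^+ 2).
  by rewrite !(sqrtrM _ (sqr_ge0 D)) sqrtr_sqr ger0_norm//; ring.
apply: ler_pM; rewrite ?sqrtr_ge0// ler_wsqrtr//.
  rewrite (sum3 (fun j k l => mu ^+ gap j k l * a j ^+ 2)).
  exact: sum_gap_sqr.
rewrite (sum3 (fun j k l => mu ^+ gap j k l * b k ^+ 2)) exchange_big/=.
apply: le_trans (sum_gap_sqr n b m0 m1); rewrite le_eqVlt; apply/orP; left; apply/eqP.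
apply: eq_bigr => k _; apply: eq_bigr => j _; apply: eq_bigr => l _.
by congr (mu ^+ _ * _); rewrite /gap; lia.
Qed.

(** * The trilinear form on finite sets of pairs *)

Lemma size_le_proj (T F G : eqType) (f : T -> F) (g : T -> G)
    (s : seq T) (u : seq F) (v : seq G) :
  uniq s -> {in s &, injective (fun x => (f x, g x))} ->
  (forall x, x \in s -> f x \in u) -> (forall x, x \in s -> g x \in v) ->
  (size s <= size u * size v)%N.
Proof.
move=> us inj fu gv; rewrite -(size_map (fun x => (f x, g x))).
rewrite -(size_allpairs pair); apply: uniq_leq_size.
  by rewrite map_inj_in_uniq.
move=> p /mapP[x xs ->]; exact: allpairs_f (fu _ xs) (gv _ xs).
Qed.

(** The shells of A, B, C cut the pairs of S into pieces of size at most
    2 ^ min (j + k, k + l, j + l), because (x + y, x), (x, y) and (x + y, y) all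
    determine (x, y).  The constant is 4 M from [sum_weak_l4], times a factor 2
    for each of the three functions from [dyadic_levels], times the constant of
    [trilinear_gap]. *)
Lemma finite_trilinear_bound (R : realType) (G : zmodType) (V : G * G -> R) (M q : R) :
  0 < M -> 1 < q -> q ^+ 8 = 2 -> (forall p, 0 <= V p) ->
  weak_l4_bound V M ->
  forall (A B C : G -> R) (S : seq (G * G)) (sA sB sC : seq G),
  (forall x, 0 <= A x) -> (forall x, 0 <= B x) -> (forall x, 0 <= C x) ->
  uniq S -> uniq sA -> uniq sB -> uniq sC ->
  (forall p, p \in S -> [/\ p.1 + p.2 \in sA, p.1 \in sB & p.2 \in sC]) ->
  \sum_(p <- S) V p * A (p.1 + p.2) * B p.1 * C p.2 <=
  32 * M * (2 / (1 - q^-1)) ^+ 2 * Num.sqrt (\sum_(x <- sA) A x ^+ 2) *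
    Num.sqrt (\sum_(x <- sB) B x ^+ 2) * Num.sqrt (\sum_(x <- sC) C x ^+ 2).
Proof.
move=> M0 q1 q8 V0 HV A B C S sA sB sC A0 B0 C0 uS uA uB uC HS.
have q0 : 0 < q by apply: lt_trans q1.
have [la [ga [ga0 Aga cA laN sumA]]] := dyadic_levels uA A0.
have [lb [gb [gb0 Bgb cB lbN sumB]]] := dyadic_levels uB B0.
have [lc [gc [gc0 Cgc cC lcN sumC]]] := dyadic_levels uC C0.
set N := (size sA + size sB + size sC)%N.
have NA : (size sA <= N)%N by rewrite /N -addnA leq_addr.
have NB : (size sB <= N)%N by rewrite /N addnAC leq_addl.
have NC : (size sC <= N)%N by rewrite /N leq_addl.
have inA x : (inord (la x) : 'I_N.+1) = la x :> nat.
  by apply: inordK; exact: leq_trans (laN x) NA.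
have inB x : (inord (lb x) : 'I_N.+1) = lb x :> nat.
  by apply: inordK; exact: leq_trans (lbN x) NB.
have inC x : (inord (lc x) : 'I_N.+1) = lc x :> nat.
  by apply: inordK; exact: leq_trans (lcN x) NC.
pose I := ('I_N.+1 * 'I_N.+1 * 'I_N.+1)%type.
pose h (p : G * G) : I := (inord (la (p.1 + p.2)), inord (lb p.1), inord (lc p.2)).
pose al j := q ^+ (4 * j) * ga j; pose be j := q ^+ (4 * j) * gb j.
pose ce j := q ^+ (4 * j) * gc j.
have al0 (g : nat -> R) : (forall j, 0 <= g j) -> forall j, 0 <= q ^+ (4 * j) * g j.
  by move=> g0 j; rewrite mulr_ge0 ?(ltW (exprn_gt0 _ q0)).
have shell (t : I) : \sum_(p <- S | h p == t) V p * A (p.1 + p.2) * B p.1 * C p.2 <=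
    4 * M * (q^-1 ^+ gap t.1.1 t.1.2 t.2 * al t.1.1 * be t.1.2 * ce t.2).
  case: t => [[j k] l] /=.
  pose E := [seq p <- S | h p == (j, k, l)].
  have EP p : p \in E -> [/\ p \in S, la (p.1 + p.2) = j, lb p.1 = k & lc p.2 = l].
    by rewrite mem_filter => /andP[/eqP[<- <- <-] ->]; rewrite inA inB inC.
  have uE : uniq E by exact: filter_uniq.
  set e := minn (minn (j + k) (k + l)) (j + l).
  have cE : (size E <= 2 ^ e)%N.
    have fa p : p \in E -> p.1 + p.2 \in [seq x <- sA | la x == j].
      by move=> /EP[/HS[h1 h2 h3] <- _ _]; rewrite mem_filter eqxx.
    have fb p : p \in E -> p.1 \in [seq x <- sB | lb x == k].
      by move=> /EP[/HS[h1 h2 h3] _ <- _]; rewrite mem_filter eqxx.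
    have fc p : p \in E -> p.2 \in [seq x <- sC | lc x == l].
      by move=> /EP[/HS[h1 h2 h3] _ _ <-]; rewrite mem_filter eqxx.
    have ejk : (size E <= 2 ^ (j + k))%N.
      rewrite expnD (leq_trans (size_le_proj uE _ fa fb))// ?leq_mul//.
      by move=> [x y] [x' y'] _ _ /= [e1 e2]; move: e1; rewrite e2 => /addrI ->.
    have ekl : (size E <= 2 ^ (k + l))%N.
      rewrite expnD (leq_trans (size_le_proj uE _ fb fc))// ?leq_mul//.
      by move=> [x y] [x' y'] _ _ /= [-> ->].
    have ejl : (size E <= 2 ^ (j + l))%N.
      rewrite expnD (leq_trans (size_le_proj uE _ fa fc))// ?leq_mul//.
      by move=> [x y] [x' y'] _ _ /= [e1 e2]; move: e1; rewrite e2 => /addIr ->.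
    by rewrite /e /minn; case: ifP => _ //; case: ifP.
  have VE := sum_weak_l4 M0 (ltW q1) q8 HV uE cE.
  rewrite -big_filter -/E.
  apply: (@le_trans _ _ (\sum_(p <- E) V p * (ga j * gb k * gc l))).
    rewrite big_seq [leRHS]big_seq; apply: ler_sum => p /EP[pS ja kb lc'].
    have [pA pB pC] := HS _ pS; rewrite -!mulrA ler_wpM2l//.
    have := Aga _ pA; have := Bgb _ pB; have := Cgc _ pC; rewrite ja kb lc' => c1 b1 a1.
    by rewrite ler_pM ?mulr_ge0// ler_pM.
  rewrite -mulr_suml.
  have g0 : 0 <= ga j * gb k * gc l by rewrite !mulr_ge0.
  apply: (le_trans (ler_wpM2r g0 VE)).
  rewrite -[leLHS]mulrA ler_wpM2l//; first by rewrite mulr_ge0// ltW.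
  have -> : q^-1 ^+ gap j k l * al j * be k * ce l =
     q ^+ (4 * j + 4 * k + 4 * l) / q ^+ gap j k l * (ga j * gb k * gc l).
    by rewrite /al /be /ce exprVn !exprD; ring.
  rewrite ler_wpM2r// ler_pdivlMr ?exprn_gt0// -exprD ler_weXn2l ?(ltW q1)//.
  (* In terms of the largest, middle and smallest index this reads
     6 (mid + min) + 2 (max - min) <= 4 (max + mid + min), i.e. mid <= max. *)
  rewrite /e /gap; lia.
rewrite (partition_big h xpredT)//=.
apply: (le_trans (ler_sum _ (fun t _ => shell t))).
rewrite -mulr_sumr.
have qi1 : q^-1 < 1 by rewrite invf_lt1.
have qi0 : 0 <= q^-1 by rewrite invr_ge0 ltW.
have key := trilinear_gap N.+1 qi0 qi1 (al0 _ ga0) (al0 _ gb0) (al0 _ gc0).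
have M40 : 0 <= 4 * M by rewrite mulr_ge0// ltW.
apply: (le_trans (ler_wpM2l M40 key)).
have sq (g : nat -> R) (s : seq G) (f : G -> R) :
    \sum_(j < N.+1) 2 ^+ j * g j ^+ 2 <= 2 * \sum_(x <- s) f x ^+ 2 ->
    Num.sqrt (\sum_(j < N.+1) (q ^+ (4 * j) * g j) ^+ 2) <=
    2 * Num.sqrt (\sum_(x <- s) f x ^+ 2).
  move=> hg; rewrite -[X in X * _](ger0_norm (ler0n R 2)) -sqrtr_sqr -sqrtrM ?sqr_ge0//.
  rewrite ler_wsqrtr//.
  have -> : \sum_(j < N.+1) (q ^+ (4 * j) * g j) ^+ 2 = \sum_(j < N.+1) 2 ^+ j * g j ^+ 2.
    apply: eq_bigr => j _; rewrite exprMn -exprM -q8 -exprM; congr (q ^+ _ * _); lia.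
  apply: (le_trans hg); have : 0 <= \sum_(x <- s) f x ^+ 2.
    by apply: sumr_ge0 => x _; exact: sqr_ge0.
  lra.
set D := (2 / _) ^+ 2; have D0 : 0 <= D by exact: sqr_ge0.
rewrite (_ : 32 = 4 * 2 * 2 * 2); last by ring.
set a := Num.sqrt (\sum_(x <- sA) _); set b := Num.sqrt (\sum_(x <- sB) _).
set c := Num.sqrt (\sum_(x <- sC) _).
have -> : 4 * 2 * 2 * 2 * M * D * a * b * c =
  4 * M * (D * (2 * a) * (2 * b) * (2 * c)) by ring.
apply: ler_wpM2l => //; apply: ler_pM (sq _ _ _ (sumC N)); last 1 first.
- apply: ler_pM (sq _ _ _ (sumB N)); last 1 first.
  + by apply: ler_wpM2l => //; exact: sq (sumA N).
  + by apply: mulr_ge0 => //; exact: sqrtr_ge0.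
  + exact: sqrtr_ge0.
- by apply: mulr_ge0; [apply: mulr_ge0 => // |]; exact: sqrtr_ge0.
- exact: sqrtr_ge0.
Qed.

(** * From extended-real norms to finite sums *)

Lemma weak_lq4_bound (R : realType) (K : countType) (V : K -> R) :
  (forall k, 0 <= V k) -> weak_lq 4 (fun k => ((V k)%:C)%C) ->
  exists2 M : R, 0 < M & weak_l4_bound V M.
Proof.
move=> V0; rewrite /weak_lq/= /weak_lq_norm; set W := ereal_sup _ => Wlt.
pose above t : set K := [set k | t < V k].
have bound (t : R) : 0 < t -> (t%:E * @counting K R (above t) `^ 4^-1 <= W)%E.
  move=> t0; apply: ereal_sup_ubound; exists t => //; congr (_ * _ `^ _)%E.
  congr counting; apply/funext => k; apply/propext; rewrite /above/=.
  by rewrite ger0_norm ?ler0c// ltcR.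
have W0 : (0 <= W)%E.
  by apply: le_trans (bound 1 ltr01); rewrite mule_ge0 ?lee_fin// poweR_ge0.
have Wfin : W \is a fin_num by rewrite ge0_fin_numE.
have w0 : 0 <= fine W by exact: fine_ge0.
exists (fine W + 1) => [|t s t0 us st]; first by rewrite ltr_wpDl.
have := bound t t0; rewrite /counting; case: asboolP => [fin|inf] h; last first.
  by move: h; rewrite /poweR gt_eqF ?invr_gt0// gt0_muley ?lte_fin// leye_eq => /eqP W_oo;
     rewrite W_oo in Wlt.
move: h; rewrite -{1}(fineK Wfin) poweR_EFin -EFinM lee_fin.
set n := size (finmap.enum_fset _) => h.
have sn : (size s <= n)%N.
  apply: uniq_leq_size us _ => k /st tk.
  by rewrite in_fset_set// inE.
apply: (@le_trans _ _ ((t * n%:R `^ 4^-1) ^+ 4)).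
  rewrite exprMn -[(_ `^ _) ^+ 4]powR_mulrn ?powR_ge0// -powRrM mulVf// powRr1//.
  by rewrite mulrC ler_wpM2l ?ler_nat// exprn_ge0// ltW.
have t1 : 0 <= t * n%:R `^ 4^-1 by rewrite mulr_ge0 ?powR_ge0// ltW.
by rewrite lerXn2r ?nnegrE ?addr_ge0// (le_trans h)// lerDl.
Qed.

(** Since the finite sums stay below the norm even when it is infinite, the
    final comparison needs no case distinction on finiteness. *)
Lemma sqrt_sum_le_l2_norm (R : realType) (K : countType) (A : K -> R) (s : seq K) :
  uniq s -> ((Num.sqrt (\sum_(k <- s) A k ^+ 2))%:E <= l2_norm A)%E.
Proof.
move=> us; have S0 : 0 <= \sum_(k <- s) A k ^+ 2.
  by apply: sumr_ge0 => k _; exact: sqr_ge0.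
rewrite /l2_norm -powR12_sqrt// -poweR_EFin.
have le_esum : ((\sum_(k <- s) A k ^+ 2)%:E <=
    \esum_(k in [set: K]) (`|A k| ^+ 2)%:E)%E.
  apply: esum_ge; exists [set` s]; first by split; [exact: finite_seq|].
  rewrite -fsbig_seq// -sumEFin le_eqVlt; apply/orP; left; apply/eqP.
  by apply: eq_bigr => k _; rewrite real_normK ?num_real.
apply: gt0_ler_poweR => //; rewrite in_itv/= leey andbT ?lee_fin//.
by apply: le_trans le_esum; rewrite lee_fin.
Qed.

Theorem proposition3p4 (R : realType) (d : nat)
    (V : 'rV[int]_d * 'rV[int]_d -> R) (V_ge0 : forall nu, 0 <= V nu)
    (V_weak_l4 : weak_lq 4 (fun nu => ((V nu)%:C)%C)) :
  classB V.
Proof.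
have [M M0 HV] := weak_lq4_bound V_ge0 V_weak_l4.
pose q : R := Num.sqrt (Num.sqrt (Num.sqrt 2)).
have q8 : q ^+ 8 = 2.
  by rewrite (exprM q 2 4) sqr_sqrtr ?sqrtr_ge0// (exprM _ 2 2) !sqr_sqrtr ?sqrtr_ge0.
have q1 : 1 < q.
  by rewrite -(@ltr_pXn2r _ 8) ?nnegrE ?sqrtr_ge0// q8 expr1n ltr1n.
have qV1 : q^-1 < 1 by rewrite invf_lt1// (lt_trans _ q1).
pose c := 32 * M * (2 / (1 - q^-1)) ^+ 2.
have c0 : 0 < c.
  apply: mulr_gt0; first exact: mulr_gt0.
  by rewrite exprn_gt0// divr_gt0// subr_gt0.
split=> //; exists c => // A B C A0 B0 C0.
apply: ge_ereal_sup => _ [F [Ffin _] <-].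
rewrite fsbig_finite//= sumEFin.
set S := finmap.enum_fset _; have uS : uniq S by exact: finmap.fset_uniq.
pose sA := undup [seq p.1 + p.2 | p <- S].
pose sB := undup [seq p.1 | p <- S]; pose sC := undup [seq p.2 | p <- S].
have inS p : p \in S -> [/\ p.1 + p.2 \in sA, p.1 \in sB & p.2 \in sC].
  move=> pS; rewrite !mem_undup; split; last 2 first.
  - exact: map_f.
  - exact: map_f.
  - exact: (map_f (fun p => p.1 + p.2)).
have := finite_trilinear_bound M0 q1 q8 V_ge0 HV A0 B0 C0 uS
  (undup_uniq _) (undup_uniq _) (undup_uniq _) inS.
rewrite -lee_fin -/c => /le_trans; apply; rewrite !EFinM.
have l2A := sqrt_sum_le_l2_norm A (undup_uniq [seq p.1 + p.2 | p <- S]).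
have l2B := sqrt_sum_le_l2_norm B (undup_uniq [seq p.1 | p <- S]).
have l2C := sqrt_sum_le_l2_norm C (undup_uniq [seq p.2 | p <- S]).
have cE0 : (0 <= c%:E)%E by rewrite lee_fin ltW.
have sqE0 (x : R) : (0 <= (Num.sqrt x)%:E)%E by rewrite lee_fin sqrtr_ge0.
apply: lee_pmul l2C => //; first by do 2![apply: mule_ge0 => //].
by apply: lee_pmul l2B => //; [apply: mule_ge0 | exact: lee_pmul].
Qed.
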